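(* Let $k\ge 1$. Consider a quasi-Newton method with exact linesearch applied to $\min_{x\in\mathbb{R}^n}\frac12 x^THx+c^Tx$, where $H=H^T\succ 0$, started at $x_0$ with $B_0=I$, so that $p_0=p_0^{CG}=-g_0$, and suppose $g_0,\dots,g_k$ are nonzero. Assume that $p_i \parallel p_i^{CG}$ for all $i\le k-1$; that the symmetric matrix $B_{k-1}=I+V_{k-1}$ satisfies $\mathcal{R}(V_{k-1})\subseteq\mathcal{K}_k(p_0,H)$; that $B_k=B_{k-1}+U_k=I+V_{k-1}+U_k$ with $U_k=U_k^T$; and that a solution $p_k$ is obtained from $B_kp_k=-g_k$. Then $p_k\parallel p_k^{CG}$ if $U_k$ satisfies (i) $\mathcal{R}(U_k)\subseteq\mathcal{K}_{k+1}(p_0,H)$, (ii) $U_kp_i=0$ for all $i\le k-2$, and (iii) $U_kp_{k-1}=(H-B_{k-1})p_{k-1}$.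
   Context: Problem: minimize $q(x)=\frac12x^THx+c^Tx$ over $\mathbb{R}^n$ with $H=H^T\succ0$; gradient $g(x)=Hx+c$, $g_k=g(x_k)$. All methods use $x_{k+1}=x_k+\alpha_kp_k$ with exact linesearch $\alpha_k=-\frac{p_k^Tg_k}{p_k^THp_k}$. Quasi-Newton method: in each iteration $i$ the direction $p_i$ is obtained as a solution of $B_ip_i=-g_i$ with $B_i$ symmetric. Conjugate gradient method (CG): started at the same $x_0$ with exact linesearch, it uses the directions $p_0^{CG}=-g_0$ and $p_k^{CG}=-g_k+\beta_{k-1}p_{k-1}^{CG}$, $\beta_{k-1}=\frac{(p_{k-1}^{CG})^THg_k}{(p_{k-1}^{CG})^THp_{k-1}^{CG}}$ for $k\geq 1$, where here $g_k$ is the gradient at the $k$-th CG iterate. Notation: $p\parallel p'$ means $p=\delta p'$ for some nonzero scalar $\delta$. $\mathcal{K}_k(b,A)=\mathrm{span}\{b,Ab,\dots,A^{k-1}b\}$ is the Krylov subspace. $\mathcal{R}(M)$ is the range space of the matrix $M$.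
   Formalization: The formal theorem additionally assumes that B_{k-1} is nonsingular; if B_{k-1} is singular, B_k is singular too, and a solution p_k of B_k p_k = -g_k need not be parallel to p_k^CG, so the claim fails as stated. *)

(* Defs.v *)
From HB Require Import structures.
From mathcomp Require Import all_boot all_order all_algebra.
From mathcomp Require Import reals.

Set Implicit Arguments.
Unset Strict Implicit.
Unset Printing Implicit Defensive.

Import Order.TTheory GRing.Theory Num.Theory.
Local Open Scope ring_scope.

Section Defs.
Variables (R : realType) (n : nat).
Implicit Types (A H V : 'M[R]_n) (b c g p u v x : 'cV[R]_n).

Definition dotv u v : R := (u^T *m v) 0 0.

Definition posdefmx H : Prop :=
  H^T = H /\ forall u, u != 0 -> 0 < dotv u (H *m u).

(* Gradient of x |-> 1/2 x^T H x + c^T x, for symmetric H. *)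
Definition grad H c x : 'cV[R]_n := H *m x + c.

Definition exact_step H c x p : R :=
  - (dotv p (grad H c x) / dotv p (H *m p)).

Definition linesearch H c x p : 'cV[R]_n := x + exact_step H c x p *: p.

Definition parallel p p' : Prop := exists2 d : R, d != 0 & p = d *: p'.

Definition krylov k b A : {vspace 'cV[R]_n} :=
  <<[seq (A ^+ i *m b : 'cV[R]_n) | i <- iota 0 k]>>%VS.

(* Range (column space) of V. *)
Definition rangemx V : {vspace 'cV[R]_n} :=
  limg (linfun (mulmx V : 'cV[R]_n -> 'cV[R]_n)).

(* Pair (iterate, direction) of the conjugate gradient method at iteration k.
   While the gradients are nonzero, no denominator vanishes. *)
Fixpoint cg H c (x0 : 'cV[R]_n) (k : nat) : 'cV[R]_n * 'cV[R]_n :=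
  if k is k'.+1 then
    let: (x, p) := cg H c x0 k' in
    let x' := linesearch H c x p in
    let g' := grad H c x' in
    (x', - g' + (dotv p (H *m g') / dotv p (H *m p)) *: p)
  else (x0, - grad H c x0).

Definition cg_dir H c (x0 : 'cV[R]_n) (k : nat) : 'cV[R]_n := (cg H c x0 k).2.

(* Iterations 0, ..., k of a quasi-Newton method with exact linesearch,
   started at x 0; the values of B, x, p beyond index k are irrelevant.
   B i may be singular, in which case p i is any solution of the system. *)
Definition quasi_newton H c (k : nat) (B : nat -> 'M[R]_n)
    (x p : nat -> 'cV[R]_n) : Prop :=
  [/\ forall i, (i <= k)%N -> (B i)^T = B i,
      forall i, (i <= k)%N -> B i *m p i = - grad H c (x i)
    & forall i, (i < k)%N -> x i.+1 = linesearch H c (x i) (p i)].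

End Defs.

(* Main.v *)
Require Import Defs.
From HB Require Import structures.
From mathcomp Require Import all_boot all_order all_algebra.
From mathcomp Require Import reals.

(** With exact linesearch and directions parallel to those of CG, the iterates
    are the CG iterates, so [K_j(p_0, H) = span (p_0^CG, ..., p_(j-1)^CG)] for
    [j <= k+1].  As [p_k = - g_k - (V + U) p_k] lies in [K_(k+1)(p_0, H)], it
    suffices that [p_k] be [H]-conjugate to the previous directions.  For
    [p_(k-1)] this follows from [B_k p_(k-1) = H p_(k-1)].  For [i <= k-2], put
    [v = B_(k-1)^-1 H p_i]; since [V] ranges in [K_k], [v] is in [K_k], and
    [- v^T g_(k-1) = v^T B_(k-1) p_(k-1) = p_i^T H p_(k-1) = 0] forces [v] into
    [K_(k-1)], where [B_k] and [B_(k-1)] agree; hence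
    [p_i^T H p_k = v^T B_k p_k = - v^T g_k = 0]. *)

Set Implicit Arguments.
Unset Strict Implicit.
Unset Printing Implicit Defensive.

Import Order.TTheory GRing.Theory Num.Theory.
Local Open Scope ring_scope.

(** * Spans of the first terms of a sequence of vectors *)

Section PrefixSpan.
Variables (K : fieldType) (vT : vectType K).
Implicit Types (f : nat -> vT) (u v : vT).

(** With [f i = A ^+ i *m b] this is convertible to [krylov m b A], so the lemmas below serve both
    Krylov subspaces and spans of CG directions. *)
Definition prefix_span f m : {vspace vT} := <<[seq f i | i <- iota 0 m]>>%VS.

Lemma prefix_span_ind f m (P : vT -> Prop) :
  P 0 -> (forall a u v, P u -> P v -> P (a *: u + v)) ->
  (forall i, (i < m)%N -> P (f i)) -> forall v, v \in prefix_span f m -> P v.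
Proof.
move=> P0 Plin Pf v vf.
have PD u w : P u -> P w -> P (u + w) by rewrite -{2}[u]scale1r; apply: Plin.
rewrite (coord_span (X := in_tuple _) vf).
elim/big_ind: _ => // i _; rewrite -[_ *: _]addr0; apply: Plin => //=.
have hi : (i < m)%N.
  by apply: leq_trans (ltn_ord i) _; rewrite size_map size_iota.
by rewrite (nth_map 0%N) ?size_iota// nth_iota//; apply: Pf.
Qed.

Lemma prefix_span_mem f m i : (i < m)%N -> f i \in prefix_span f m.
Proof. by move=> im; apply/memv_span/map_f; rewrite mem_iota. Qed.

Lemma prefix_span_sub f m (W : {vspace vT}) :
  (forall i, (i < m)%N -> f i \in W) -> (prefix_span f m <= W)%VS.
Proof.
move=> fW; apply/span_subvP => _ /mapP[i + ->].
by rewrite mem_iota; apply: fW.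
Qed.

Lemma prefix_span_mono f m m' :
  (m <= m')%N -> (prefix_span f m <= prefix_span f m')%VS.
Proof.
by move=> mm'; apply: prefix_span_sub => i im;
  apply/prefix_span_mem/(leq_trans im).
Qed.

Lemma prefix_spanSP f m v : v \in prefix_span f m.+1 ->
  exists2 u, u \in prefix_span f m & exists a, v = u + a *: f m.
Proof.
rewrite /prefix_span -addn1 iotaD map_cat span_cat /= span_seq1.
by case/memv_addP=> u ufm [_ /vlineP[a ->] ->]; exists u => //; exists a.
Qed.

End PrefixSpan.

(** * Dot products, ranges and Krylov subspaces *)

Section DotProduct.
Variables (R : realType) (n : nat).
Implicit Types (u v w : 'cV[R]_n) (A : 'M[R]_n).

Lemma dotvC u v : dotv u v = dotv v u.
Proof. by rewrite /dotv -[u^T *m v]trmxK trmx_mul trmxK mxE. Qed.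

Lemma dotvDr u v w : dotv u (v + w) = dotv u v + dotv u w.
Proof. by rewrite /dotv mulmxDr mxE. Qed.

Lemma dotvZr a u v : dotv u (a *: v) = a * dotv u v.
Proof. by rewrite /dotv -scalemxAr mxE. Qed.

Lemma dotvNr u v : dotv u (- v) = - dotv u v.
Proof. by rewrite -scaleN1r dotvZr mulN1r. Qed.

Lemma dotv0r u : dotv u 0 = 0.
Proof. by rewrite /dotv mulmx0 mxE. Qed.

Lemma dotvDl u v w : dotv (u + v) w = dotv u w + dotv v w.
Proof. by rewrite dotvC dotvDr !(dotvC w). Qed.

Lemma dotvZl a u v : dotv (a *: u) v = a * dotv u v.
Proof. by rewrite dotvC dotvZr dotvC. Qed.

Lemma dotvNl u v : dotv (- u) v = - dotv u v.
Proof. by rewrite dotvC dotvNr dotvC. Qed.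

Lemma dotv0l u : dotv 0 u = 0.
Proof. by rewrite dotvC dotv0r. Qed.

Lemma dotv_sym A u v : A^T = A -> dotv u (A *m v) = dotv (A *m u) v.
Proof. by move=> AT; rewrite /dotv trmx_mul AT mulmxA. Qed.

Lemma dotv_eq0 u : dotv u u = 0 -> u = 0.
Proof.
move=> uu0; apply/matrixP => i j; rewrite ord1 mxE.
have : \sum_k u k 0 ^+ 2 = 0.
  by apply: etrans uu0; rewrite /dotv mxE; apply: eq_bigr => k _; rewrite mxE expr2.
move/eqP; rewrite psumr_eq0; last by move=> *; apply: sqr_ge0.
by move/allP/(_ i (mem_index_enum _)); rewrite sqrf_eq0 => /eqP.
Qed.

Lemma dotv_prefix_span (f : nat -> 'cV[R]_n) m u v :
  (forall i, (i < m)%N -> dotv (f i) u = 0) ->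
  v \in prefix_span f m -> dotv v u = 0.
Proof.
move=> fu; apply: (prefix_span_ind (P := fun w => dotv w u = 0)) => //.
  exact: dotv0l.
by move=> a w w' wu w'u; rewrite dotvDl dotvZl wu w'u mulr0 addr0.
Qed.

Lemma mulmx_prefix_span (f : nat -> 'cV[R]_n) m A v (W : {vspace 'cV[R]_n}) :
  (forall i, (i < m)%N -> A *m f i \in W) ->
  v \in prefix_span f m -> A *m v \in W.
Proof.
move=> fW; apply: (prefix_span_ind (P := fun w => A *m w \in W)) => //.
  by rewrite mulmx0 mem0v.
by move=> a w w' wW w'W; rewrite mulmxDr -scalemxAr memvD ?memvZ.
Qed.

Lemma mem_rangemx A v : A *m v \in rangemx A.
Proof. by rewrite /rangemx -(lfunE (mulmx A)) memv_img ?memvf. Qed.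

Lemma mulmx_krylov A b m v :
  v \in krylov m b A -> A *m v \in krylov m.+1 b A.
Proof.
apply: (mulmx_prefix_span (f := fun i => A ^+ i *m b)) => i im.
rewrite mulmxA -[A *m _]/(A * A ^+ i) -exprS.
exact: (prefix_span_mem (fun i => A ^+ i *m b)).
Qed.

Lemma krylov_mono m m' b A : (m <= m')%N -> (krylov m b A <= krylov m' b A)%VS.
Proof. exact: prefix_span_mono. Qed.

End DotProduct.

(** * Exact linesearch and the conjugate gradient method *)

Section ConjugateGradient.
Variables (R : realType) (n : nat) (H : 'M[R]_n) (c x0 : 'cV[R]_n) (k : nat).
Hypothesis Hpd : posdefmx H.

Lemma posdef_sym : H^T = H. Proof. by case: Hpd. Qed.

Lemma posdef_neq0 (u : 'cV[R]_n) : u != 0 -> dotv u (H *m u) != 0.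
Proof. by case: Hpd => _ Hp u0; rewrite gt_eqF ?Hp. Qed.

Lemma grad_linesearch (y q : 'cV[R]_n) :
  grad H c (linesearch H c y q) = grad H c y + exact_step H c y q *: (H *m q).
Proof. by rewrite /grad /linesearch mulmxDr -scalemxAr addrAC. Qed.

Lemma linesearch_orth (y q : 'cV[R]_n) :
  dotv q (grad H c (linesearch H c y q)) = 0.
Proof.
rewrite grad_linesearch dotvDr dotvZr /exact_step mulNr.
have [->|q0] := eqVneq q 0; first by rewrite !dotv0l mul0r mul0r subrr.
by rewrite divfK ?posdef_neq0// subrr.
Qed.

(** Scaling the direction by [d] divides the exact step by [d]. Hence directions parallel to those
    of CG generate the CG iterates. *)
Lemma linesearchZ (y q : 'cV[R]_n) d : d != 0 ->
  linesearch H c y (d *: q) = linesearch H c y q.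
Proof.
move=> d0; rewrite /linesearch /exact_step -scalemxAr !dotvZl !dotvZr scalerA.
congr (_ + _ *: _); rewrite mulNr; congr (- _).
rewrite invfM mulrACA divff// mul1r invfM -mulrA; congr (_ * _).
by rewrite mulrC mulVKf.
Qed.

Let X i := (cg H c x0 i).1.
Let D := cg_dir H c x0.
Let G i := grad H c (X i).
Let beta i := dotv (D i) (H *m G i.+1) / dotv (D i) (H *m D i).

Lemma cg_iterS i : X i.+1 = linesearch H c (X i) (D i).
Proof. by rewrite /X /D /cg_dir /=; case: (cg H c x0 i). Qed.

Lemma cg_dirS i : D i.+1 = - G i.+1 + beta i *: D i.
Proof. by rewrite /beta /G /X /D /cg_dir /=; case: (cg H c x0 i). Qed.

Lemma cg_gradS i : G i.+1 = G i + exact_step H c (X i) (D i) *: (H *m D i).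
Proof. by rewrite /G cg_iterS grad_linesearch. Qed.

Lemma cg_grad_orth_prev i : dotv (D i) (G i.+1) = 0.
Proof. by rewrite /G cg_iterS linesearch_orth. Qed.

(** In the recurrence for [D i], the multiple of the previous direction is orthogonal to [G i] by
    exact linesearch. A nonzero gradient therefore makes this product, and with it the step length,
    nonzero. *)
Lemma cg_dir_grad i : dotv (D i) (G i) = - dotv (G i) (G i).
Proof.
case: i => [|i]; first by rewrite dotvNl.
by rewrite {1}cg_dirS dotvDl dotvNl dotvZl cg_grad_orth_prev mulr0 addr0.
Qed.

Lemma cg_grad_span i : G i \in prefix_span D i.+1.
Proof.
have DS j m : (j < m)%N -> D j \in prefix_span D m by apply: prefix_span_mem.
case: i => [|i]; first by rewrite -[G 0]opprK memvN; apply: (DS 0%N).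
have -> : G i.+1 = beta i *: D i - D i.+1.
  by rewrite cg_dirS opprD opprK addrC subrK.
by rewrite memvB ?memvZ ?DS.
Qed.

Hypothesis Gneq0 : forall i, (i <= k)%N -> G i != 0.

Lemma cg_dir_grad_neq0 i : (i <= k)%N -> dotv (D i) (G i) != 0.
Proof.
move=> ik; rewrite cg_dir_grad oppr_eq0; apply/eqP => /dotv_eq0/eqP.
exact/negP/Gneq0.
Qed.

Lemma cg_dir_neq0 i : (i <= k)%N -> D i != 0.
Proof.
by move/cg_dir_grad_neq0; apply: contraNneq => ->; rewrite dotv0l.
Qed.

(** The difference [G i.+1 - G i] is [H *m D i] times the step length, which can be divided out;
    both gradients lie in the span. *)
Lemma cg_mul_dir_span i : (i < k)%N -> H *m D i \in prefix_span D i.+2.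
Proof.
move=> ik; have ik' := ltnW ik.
set s := exact_step H c (X i) (D i).
have s0 : s != 0.
  rewrite oppr_eq0 mulf_neq0 ?invr_eq0 ?cg_dir_grad_neq0//.
  by rewrite posdef_neq0// cg_dir_neq0.
have -> : H *m D i = s^-1 *: (G i.+1 - G i).
  by rewrite cg_gradS -/s addrC addrA addNr add0r scalerA mulVf ?scale1r.
rewrite memvZ ?memvB ?cg_grad_span//.
exact: (subvP (prefix_span_mono _ (leqnSn _))) (cg_grad_span i).
Qed.

(** Both claims go through one induction: the update of the gradient needs the previous conjugacy,
    and conjugacy of the new direction needs orthogonality of the new gradient. *)
Lemma cg_orth m : (m <= k)%N -> forall i, (i < m)%N ->
  dotv (D i) (G m) = 0 /\ dotv (D i) (H *m D m) = 0.
Proof.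
elim: m => // m IH mk.
have IHm := IH (ltnW mk).
have oG i : (i < m.+1)%N -> dotv (D i) (G m.+1) = 0.
  rewrite ltnS leq_eqVlt => /orP[/eqP->|im]; first exact: cg_grad_orth_prev.
  by have [h1 h2] := IHm i im; rewrite cg_gradS dotvDr dotvZr h1 h2 mulr0 addr0.
move=> i im; split; first exact: oG.
rewrite cg_dirS mulmxDr mulmxN -scalemxAr dotvDr dotvNr dotvZr.
move: im; rewrite ltnS leq_eqVlt => /orP[/eqP->|im].
  (* [beta] is chosen precisely to cancel this product. *)
  by rewrite /beta divfK ?addNr// posdef_neq0// cg_dir_neq0// ltnW.
have [_ ->] := IHm i im; rewrite mulr0 addr0 dotv_sym ?posdef_sym//.
rewrite (dotv_prefix_span oG) ?oppr0//.
(* Since [i < m], the vector [H *m D i] only involves [D 0, ..., D m], all orthogonal to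
   [G m.+1]. *)
apply: (subvP (prefix_span_mono D (im : (i.+2 <= m.+1)%N))).
exact/cg_mul_dir_span/(ltn_trans im).
Qed.

Lemma cg_dir_krylov i :
  D i \in krylov i.+1 (D 0%N) H /\ G i \in krylov i.+1 (D 0%N) H.
Proof.
elim: i => [|i [Di Gi]].
  have DK : D 0%N \in krylov 1 (D 0%N) H.
    by apply/memv_span; rewrite /= expr0 mul1mx mem_head.
  by split=> //; rewrite -[G 0]opprK memvN.
have inc := subvP (krylov_mono (D 0%N) H (leqnSn i.+1)).
have GS : G i.+1 \in krylov i.+2 (D 0%N) H.
  by rewrite cg_gradS memvD ?memvZ ?mulmx_krylov ?inc.
by split=> //; rewrite cg_dirS memvD ?memvN ?memvZ ?GS ?inc.
Qed.

(** By induction the power [H ^+ i] sends [D 0] into the span of [D 0, ..., D i], as [H] raises the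
    last index by at most one; the bound on [m] keeps [H] applied to directions of index below [k].
    The converse inclusion comes from the CG recurrences. *)
Lemma cg_krylovE m : (m <= k.+1)%N -> krylov m (D 0%N) H = prefix_span D m.
Proof.
move=> mk; apply/eqP; rewrite eqEsubv; apply/andP; split.
  apply: prefix_span_sub => i im.
  apply: (subvP (prefix_span_mono D im)).
  elim: i im => [|i IH] im; first by rewrite expr0 mul1mx prefix_span_mem.
  rewrite exprS -[H * _]/(H *m _) -mulmxA.
  apply: mulmx_prefix_span (IH (ltnW im)) => j ji.
  apply: (subvP (prefix_span_mono D (ji : (j.+2 <= i.+2)%N))).
  apply: cg_mul_dir_span; apply: leq_trans ji _.
  by rewrite -ltnS (leq_trans im).
apply: prefix_span_sub => i im; apply: (subvP (krylov_mono _ _ im)).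
by case: (cg_dir_krylov i).
Qed.

(** Write [q = u + a *: D k] with [u] in the span of the earlier directions. Both [q] and [D k] are
    conjugate to that span, so [u] is conjugate to itself and vanishes by positive definiteness. *)
Lemma cg_dir_unique q : q \in prefix_span D k.+1 -> q != 0 ->
  (forall i, (i < k)%N -> dotv (D i) (H *m q) = 0) -> parallel q (D k).
Proof.
case/prefix_spanSP=> u uS [a ->] q0 conj; exists a.
  apply: contraNneq q0 => a0; move: conj; rewrite a0 scale0r addr0 => conj.
  apply: contraT => /posdef_neq0; rewrite (dotv_prefix_span conj uS).
  by rewrite eqxx.
suff -> : u = 0 by rewrite add0r.
apply/eqP; apply: contraT => /posdef_neq0.
have := dotv_prefix_span conj uS; rewrite mulmxDr -scalemxAr dotvDr dotvZr.
have oDk i : (i < k)%N -> dotv (D i) (H *m D k) = 0.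
  by move=> ik; have [] := cg_orth (leqnn k) ik.
by rewrite (dotv_prefix_span oDk uS) mulr0 addr0 => ->; rewrite eqxx.
Qed.

End ConjugateGradient.

(** * The quasi-Newton direction is parallel to the CG direction *)

Theorem proposition3p3 (R : realType) (n k : nat) (H : 'M[R]_n)
    (c : 'cV[R]_n) (B : nat -> 'M[R]_n) (x p : nat -> 'cV[R]_n)
    (V U : 'M[R]_n) :
  (1 <= k)%N ->
  posdefmx H ->
  quasi_newton H c k B x p ->
  B 0%N = 1%:M ->
  (forall i, (i <= k)%N -> grad H c (x i) != 0) ->
  (forall i, (i <= k.-1)%N -> parallel (p i) (cg_dir H c (x 0%N) i)) ->
  B k.-1 = 1%:M + V ->
  (rangemx V <= krylov k (p 0%N) H)%VS ->
  B k.-1 \in unitmx ->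
  B k = B k.-1 + U ->
  U^T = U ->
  (rangemx U <= krylov k.+1 (p 0%N) H)%VS ->
  (forall i, (i.+2 <= k)%N -> U *m p i = 0) ->
  U *m p k.-1 = (H - B k.-1) *m p k.-1 ->
  parallel (p k) (cg_dir H c (x 0%N) k).
Proof.
(* From here on the current index is [m.+1] and the previous one is [m]. *)
case: k => // m _ Hpd [Bsym Bp xS] B0 g0 par /= BV VK Bu BU _ UK Up Upm.
have HT := posdef_sym Hpd.
set D := cg_dir H c (x 0%N).
have xE i : (i <= m.+1)%N -> x i = (cg H c (x 0%N) i).1.
  elim: i => // i IH im; rewrite xS// cg_iterS IH ?(ltnW im)//.
  by have [d d0 ->] := par i im; rewrite linesearchZ.
have G0 i : (i <= m.+1)%N -> grad H c (cg H c (x 0%N) i).1 != 0.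
  by move=> im; rewrite -xE// g0.
have p0E : p 0%N = D 0%N by rewrite -[p 0%N]mul1mx -B0 Bp.
have KE j : (j <= m.+2)%N -> krylov j (p 0%N) H = prefix_span D j.
  by move=> jm; rewrite p0E (cg_krylovE Hpd G0).
rewrite !KE// in VK UK.
have [dm dm0 pmE] := par m (leqnn m).
have Dpar i q : (i <= m)%N -> dotv (p i) q = 0 -> dotv (D i) q = 0.
  move=> im; have [d d0 ->] := par i im; rewrite dotvZl => /eqP.
  by rewrite mulf_eq0 (negbTE d0) => /eqP.
have UD i : (i < m)%N -> U *m D i = 0.
  move=> im; have [d d0 piE] := par i (ltnW im).
  have := Up i im; rewrite piE -scalemxAr => /eqP.
  by rewrite scaler_eq0 (negbTE d0) => /eqP.
have Dgk i : (i < m.+1)%N -> dotv (D i) (grad H c (x m.+1)) = 0.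
  by move=> im; rewrite xE//; have [] := cg_orth Hpd G0 (leqnn _) im.
have Bpk : B m.+1 *m p m.+1 = - grad H c (x m.+1) by apply: Bp.
apply: (cg_dir_unique Hpd G0) => [||i].
- have -> : p m.+1 = - grad H c (x m.+1) - U *m p m.+1 - V *m p m.+1.
    by rewrite -Bpk BU BV !mulmxDl mul1mx !addrK.
  rewrite !memvB ?memvN//.
  + by rewrite xE//; apply: cg_grad_span.
  + exact: (subvP UK) (mem_rangemx _ _).
  + apply: (subvP (prefix_span_mono D (leqnSn _))).
    exact: (subvP VK) (mem_rangemx _ _).
- apply: contraTneq (g0 m.+1 (leqnn _)) => pk0.
  by rewrite -oppr_eq0 -Bpk pk0 mulmx0 eqxx.
rewrite ltnS leq_eqVlt => /orP[/eqP->|im].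
  (* Conjugacy to the last direction: condition (iii) gives the secant equation
     [B m.+1 *m p m = H *m p m]. *)
  apply: Dpar => //; rewrite dotv_sym//.
  have -> : H *m p m = B m.+1 *m p m by rewrite BU mulmxDl Upm mulmxBl addrC subrK.
  rewrite -dotv_sym ?Bsym// Bpk dotvNr pmE dotvZl Dgk//.
  by rewrite mulr0 oppr0.
set v := invmx (B m) *m (H *m D i).
have Bv : B m *m v = H *m D i by rewrite mulKVmx.
(* Solve [B m *m v = H *m D i] for the identity part of [B m]: as [i < m], both [H *m D i] and the
   range of [V] lie in the span. *)
have vS : v \in prefix_span D m.+1.
  have -> : v = H *m D i - V *m v by rewrite -Bv BV mulmxDl mul1mx addrK.
  rewrite memvB//; last exact: (subvP VK) (mem_rangemx _ _).
  apply: (subvP (prefix_span_mono D (im : (i.+2 <= m.+1)%N))).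
  by apply: (cg_mul_dir_span Hpd G0); apply: leqW.
have [u uS [a vE]] := prefix_spanSP vS.
have orthm j : (j < m)%N -> dotv (D j) (grad H c (x m)) = 0 /\
    dotv (D j) (H *m D m) = 0.
  by move=> jm; rewrite xE//; have [] := cg_orth Hpd G0 (leqnSn m) jm.
(* Pairing [v] with the gradient at [x m] isolates [a], since that gradient is orthogonal to the
   [D j] with [j < m] but not to [D m]. *)
have a0 : a = 0.
  have : dotv v (grad H c (x m)) = 0.
    rewrite -[grad _ _ _]opprK -Bp// dotvNr dotv_sym ?Bsym// Bv -dotv_sym//.
    by rewrite pmE -scalemxAr dotvZr (orthm i im).2 mulr0 oppr0.
  have og j : (j < m)%N -> dotv (D j) (grad H c (x m)) = 0 by move/orthm=> [].
  rewrite vE dotvDl (dotv_prefix_span og uS) add0r dotvZl => /eqP.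
  rewrite xE// mulf_eq0 (negbTE (cg_dir_grad_neq0 Hpd G0 (leqnSn m))) orbF.
  by move/eqP.
have vSm : v \in prefix_span D m by rewrite vE a0 scale0r addr0.
(* Without a [D m] component, [v] is annihilated by [U] through condition (ii), so [B m] may be
   replaced by [B m.+1] on [v]. *)
have Uv : U *m v = 0.
  apply/eqP; rewrite -memv0; apply: mulmx_prefix_span vSm => j jm.
  by rewrite UD// mem0v.
rewrite dotv_sym// -Bv.
have -> : B m *m v = B m.+1 *m v by rewrite BU mulmxDl Uv addr0.
by rewrite -dotv_sym ?Bsym// Bpk dotvNr (dotv_prefix_span Dgk vS) oppr0.
Qed.
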